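(* Let $G$ be a finite connected simple graph with $d$ vertices and $e$ edges, and let $c_4(G)$ denote the number of $4$-cycles of $G$. Suppose that $G$ has at least one odd cycle. Then $$c_4(G) \le \binom{e-d+1}{2}.$$
   Context: A $4$-cycle of $G$ is a subgraph of $G$ isomorphic to the cycle $C_4$; $c_4(G)$ counts these subgraphs. *)

(* Defs.v *)
From HB Require Import structures.
From mathcomp Require Import all_boot.

Set Implicit Arguments.
Unset Strict Implicit.
Unset Printing Implicit Defensive.

Record sgraph := SGraph {
  vertex :> finType;
  adj : rel vertex;
  adj_sym : symmetric adj;
  adj_irr : irreflexive adj }.

Definition connected_graph (G : sgraph) : Prop :=
  forall x y : G, connect (@adj G) x y.

Definition edges (G : sgraph) : {set {set G}} :=
  [set [set p.1; p.2] | p in [set q : G * G | adj q.1 q.2]].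

(* A pair H = (vertex set, edge set). *)
Definition is_subgraph (G : sgraph) (H : {set G} * {set {set G}}) : bool :=
  (H.2 \subset edges G) && [forall A in H.2, A \subset H.1].

(* f is injective with image the vertices of H, and induces a bijection between
   the edges of F and those of H: a graph isomorphism from F onto H. *)
Definition iso_to (F G : sgraph) (H : {set G} * {set {set G}}) : bool :=
  [exists f : {ffun F -> G},
     [&& injectiveb f, f @: [set: F] == H.1 &
         [set f @: (A : {set F}) | A in edges F] == H.2]].

(* ordS is the successor modulo n; the conjunct i != j only matters for n = 1. *)
Definition cycle_adj (n : nat) : rel 'I_n :=
  fun i j => (i != j) && ((j == ordS i) || (i == ordS j)).

Lemma cycle_adj_sym (n : nat) : symmetric (@cycle_adj n).
Proof. by move=> i j; rewrite /cycle_adj eq_sym orbC. Qed.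

Lemma cycle_adj_irr (n : nat) : irreflexive (@cycle_adj n).
Proof. by move=> i; rewrite /cycle_adj eqxx. Qed.

(* This is the cycle C_n only for n >= 3. *)
Definition cycle_graph (n : nat) : sgraph :=
  SGraph (@cycle_adj_sym n) (@cycle_adj_irr n).

Definition is_cycle (n : nat) (G : sgraph) (H : {set G} * {set {set G}}) : bool :=
  is_subgraph H && iso_to (cycle_graph n) H.

Definition c4 (G : sgraph) : nat :=
  #|[set H : {set G} * {set {set G}} | is_cycle 4 H]|.

Definition has_odd_cycle (G : sgraph) : Prop :=
  exists n : nat, [/\ 3 <= n, odd n &
    exists H : {set G} * {set {set G}}, is_cycle n H].

(* Main.v *)
Require Import Defs.
From mathcomp Require Import all_boot zify.

(* Take a minimal vertex set W inducing a non-bipartite subgraph: it is connected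
   and contains no 4-cycle. Grow W to the whole graph, one vertex v adjacent to
   the current set B at a time; let N be the neighbourhood of v in B, d = |N|,
   and b = e(B) - |B| + 1 >= 1. The 4-cycles through v are counted by pairs of
   common neighbours, so there are at most sum_{x in B} C(t_x, 2) of them, where
   t_x = |N(x) :&: N|, and it suffices that this is at most
   C(b + d - 1, 2) - C(b, 2).
   Let q = e(N) and let S be the sum of the t_x - 1 over the x in B \ N with
   t_x > 0. Growing N to B inside B gives b + d - 1 >= S + q, and also
   b + d - 1 >= S + 1 since B is not bipartite. If m is the number of
   non-isolated vertices of B[N], each has degree t between 1 and m - 1 there, so
   t^2 + m - 1 <= t m; this bounds the sum over N, while the sum over B \ N is at
   most S min(d, S + 1) / 2. *)

Set Implicit Arguments.
Unset Strict Implicit.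
Unset Printing Implicit Defensive.

(** * Arithmetic of one growth step *)

(* X and Y are twice the sums over N and over B \ N; here d is |N| - 1. *)
Lemma step_arith (d b q S m X Y : nat) :
  0 < d -> m <= d.+1 -> X + 2 * q + m * m.-1 <= 2 * q * m ->
  Y <= d.+1 * S -> Y <= S.+1 * S -> S + q <= b + d -> S < b + d ->
  X + Y <= 2 * (d * b) + d * d.-1.
Proof.
move=> d0 md hX hY1 hY2 h1 h2.
have hm : m * m.-1 + m = m * m by rewrite -mulnSr; case: (m).
have hd : d * d.-1 + d = d * d by rewrite -mulnSr prednK.
(* [hX] bounds [X + q] by q^2 - (q - m)(q - m + 1), and a product of two consecutive integers is
   nonnegative. *)
have hXq : X + q <= q * q.
  case: (leqP m q) => [/subnKC|/ltnW/subnKC]; move: (_ - _) => k E; subst; nia.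
(* Since d <= q, the bound on [X] from [hX] does not decrease as m grows up to d + 1, so m = d + 1
   is the extreme case. *)
have hXd : d <= q -> X + d * d.+1 <= 2 * (d * q).
  move=> dq; have [md1|[k E]] : m = d.+1 \/ exists k, d = m + k.
    - by case: (leqP m d) => ?; [right; exists (d - m) | left]; lia.
    - by subst m; rewrite /= in hX; lia.
  have [j Ej] : exists j, q = d + j by exists (q - d); lia.
  clear - hX hm E Ej; subst q d; nia.
have hb1 : d * (S + q) <= d * (b + d) by rewrite leq_mul2l h1 orbT.
have hb2 : d * S.+1 <= d * (b + d) by rewrite leq_mul2l h2 orbT.
have small t : t <= d -> t * t + d <= d * d + t.
  move=> /subnKC; move: (_ - _) => k E; clear - E d0; subst d; nia.
case: (posnP q) => [q0|q0].
  have X0 : X = 0 by clear - hXq q0; subst q; lia.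
  case: (leqP d S) => hS.
    have : d * d + S <= d * S + d.
      move/subnKC: hS d0; move: (_ - _) => k <-; clear; nia.
    clear - X0 hY1 hb2 hd; lia.
  (* [hS] reads [S.+1 <= d], so [small] applies at [S.+1] and gives S(S + 1) <= d(d - 1). *)
  have := small _ hS; clear - X0 hY2 hd; lia.
case: (leqP d q) => hq.
  have := hXd hq; have : S <= d * S by rewrite leq_pmull.
  clear - hb1 hY1 hd; lia.
case: (leqP (S + q) d) => hS.
  have := small _ hS; have : S <= S * q by rewrite leq_pmulr.
  clear - hXq hY2 hd; lia.
(* With r = d - q the two sides differ by (d - 1)S - r(r + 1), where r <= d - 1 and r + 1 <= S. *)
have : q * q + d.+1 * S + d * d.+1 <= 2 * (d * (S + q)) + q.
  have [j E2] : exists j, d = q + j.+1 by exists (d - q.+1); lia.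
  have [k E] : exists k, S = j.+1 + k.+1 by exists (S + q - d.+1); lia.
  clear - E E2 q0; subst d S; nia.
clear - hb1 hXq hY1 hd; lia.
Qed.

(** * Edges and neighbourhoods in induced subgraphs *)

Lemma edgeP (G : sgraph) (X : {set G}) :
  reflect (exists x y, adj x y /\ X = [set x; y]) (X \in edges G).
Proof.
apply: (iffP imsetP) => [[[x y]]|[x [y [xy ->]]]].
  by rewrite inE => /= xy ->; exists x, y.
by exists (x, y); rewrite ?inE.
Qed.

Section FourCycles.
Variable G : sgraph.
Implicit Types (A B N W : {set G}) (x y v : G).

Definition nbh A x : {set G} := [set y in A | adj x y].

Definition edges_in A : {set {set G}} := [set X in edges G | X \subset A].

Lemma adj_neq x y : adj x y -> x != y.
Proof. by apply: contraTneq => ->; rewrite adj_irr. Qed.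

Lemma card_edges_inU1 A v : v \notin A ->
  #|edges_in (v |: A)| = #|edges_in A| + #|nbh A v|.
Proof.
move=> vA.
have -> : edges_in (v |: A)
    = edges_in A :|: [set [set v; y] | y in nbh A v].
  apply/setP=> X; rewrite !inE; apply/andP/orP.
    move=> [/edgeP[x [y [xy ->]]]].
    rewrite subUset !sub1set !inE => /andP[].
    have exy : [set x; y] \in edges G by apply/edgeP; exists x, y.
    case/orP=> [/eqP xv|xA] /orP[/eqP yv|yA].
    - by move: xy; rewrite xv yv adj_irr.
    - by right; apply/imsetP; exists y; rewrite ?inE ?yA -?xv.
    - right; apply/imsetP; exists x; last by rewrite yv setUC.
      by rewrite !inE xA -yv adj_sym.
    - by left; rewrite exy subUset !sub1set xA yA.
  case=> [/andP[eX XA]|/imsetP[y]].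
    by rewrite eX (subset_trans XA) ?subsetUr.
  rewrite inE => /andP[yA vy] ->; split; first by apply/edgeP; exists v, y.
  by rewrite subUset !sub1set !inE eqxx yA orbT.
rewrite cardsU disjoint_setI0 ?cards0 ?subn0.
  congr (_ + _); apply: card_in_imset => y z.
  rewrite !inE => /andP[_ /adj_neq vy] /andP[_ /adj_neq vz] /setP/(_ y).
  by rewrite !inE eqxx orbT eq_sym (negPf vy) => /esym/eqP.
rewrite disjoints_subset; apply/subsetP=> X; rewrite !inE => /andP[_ XA].
apply/imsetP=> -[y _ eX]; case/negP: vA.
by apply: (subsetP XA); rewrite eX !inE eqxx.
Qed.

Lemma finset_ind (P : {set G} -> Prop) :
  P set0 -> (forall A v, v \notin A -> P A -> P (v |: A)) -> forall A, P A.
Proof.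
move=> P0 PS A; move: {2}#|A| (erefl #|A|) => n.
elim: n A => [|n IH] A cA.
  by move/eqP: cA; rewrite cards_eq0 => /eqP->.
have /card_gt0P[v vA] : 0 < #|A| by rewrite cA.
rewrite -(setD1K vA); apply: PS; first by rewrite !inE eqxx.
by apply: IH; move: (cardsD1 v A); rewrite vA cA => -[].
Qed.

Lemma card_nbhU1 A v x : v \notin A ->
  #|nbh (v |: A) x| = adj x v + #|nbh A x|.
Proof.
move=> vA; rewrite (cardsD1 v) !inE eqxx /=; congr (_ + _).
apply: eq_card => y; rewrite !inE; case: eqP => [->|//].
by rewrite (negPf vA).
Qed.

(** Handshake lemma for the induced subgraph. *)
Lemma sum_card_nbh A : \sum_(x in A) #|nbh A x| = 2 * #|edges_in A|.
Proof.
elim/finset_ind: A => [|A v vA IH].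
  rewrite big_set0; apply/esym/eqP; rewrite muln_eq0 /= cards_eq0.
  apply/eqP/setP=> X; rewrite !inE subset0; apply/negP=> /andP[/edgeP].
  move=> [x [y [_ ->]]] /eqP/setP/(_ x); by rewrite !inE eqxx.
rewrite big_setU1 //= card_edges_inU1 // card_nbhU1 // adj_irr add0n.
under eq_bigr => x _ do rewrite card_nbhU1 //.
rewrite big_split /= IH.
suff -> : \sum_(x in A) adj x v = #|nbh A v| by rewrite mulnDr addnA addnn -mul2n addnC.
rewrite -sum1_card big_mkcond [RHS]big_mkcond /=; apply: eq_bigr => x _.
by rewrite !inE adj_sym; case: (x \in A); case: adj.
Qed.

(** * Connectedness and growth *)

(** Connectedness of the subgraph induced on [W], put in terms of cuts because growing a set needs a
    crossing edge at each stage. *)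
Definition cut_connected W :=
  forall A, A \subset W -> A != set0 -> A != W ->
    exists x y, [/\ x \in A, y \in W :\: A & adj x y].

Lemma cut_connected_ind W (P : {set G} -> Prop) N :
    cut_connected W -> N \subset W -> N != set0 -> P N ->
    (forall B y, N \subset B -> B \subset W -> y \in W -> y \notin B ->
      nbh B y != set0 -> P B -> P (y |: B)) ->
  P W.
Proof.
move=> cW NW N0 PN PS.
suff H n A : #|W :\: A| = n -> N \subset A -> A \subset W -> P A -> P W.
  exact: (H _ N).
elim: n A => [|n IH] A cA NA AW PA.
  by move/eqP: cA; rewrite cards_eq0 setD_eq0 => WA; rewrite (_ : W = A) //;
    apply/eqP; rewrite eqEsubset WA.
have [||x [y [xA]]] := cW A AW.
- by apply: contraNneq N0 => A0; rewrite -subset0 -A0.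
- by apply/eqP=> AE; rewrite AE setDv cards0 in cA.
rewrite inE => /andP[yA yW] xy.
apply: (IH (y |: A)); rewrite ?subUset ?sub1set ?yW ?AW //.
- have := cardsD1 y (W :\: A); rewrite cA !inE yA yW /= => -[->].
  by apply: eq_card => z; rewrite !inE negb_or andbA.
- by rewrite (subset_trans NA) ?subsetUr.
- apply: PS => //; apply/set0Pn; exists x.
  by rewrite inE xA adj_sym.
Qed.

(** A cut of the larger set either restricts to a proper cut of [W] or separates [v] from all of
    [W]; in the second case the edge from [v] to [w] crosses it. *)
Lemma cut_connectedU1 W v : cut_connected W -> nbh W v != set0 ->
  cut_connected (v |: W).
Proof.
move=> cW /set0Pn[w]; rewrite inE => /andP[wW vw] A AvW A0 AnvW.
case: (boolP (v \in W)) => vW.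
  by rewrite (setUidPr _) ?sub1set // in AvW AnvW *; exact: cW.
have [E|E] := eqVneq (A :&: W) set0.
  have AE z : z \in A -> z = v.
    move=> zA; have := subsetP AvW z zA; rewrite !inE => /orP[/eqP//|zW].
    by move/setP/(_ z): E; rewrite !inE zA zW.
  have vA : v \in A by case/set0Pn: A0 => z zA; rewrite -(AE z zA).
  exists v, w; split=> //; rewrite !inE wW orbT andbT.
  by apply: contra vW => /AE <-.
have [F|F] := eqVneq (A :&: W) W.
  have WA : W \subset A by rewrite -F subsetIl.
  have vA : v \notin A.
    apply: contra AnvW => vA; rewrite eqEsubset AvW subUset sub1set vA.
    by rewrite WA.
  exists w, v; rewrite (subsetP WA) // !inE vA eqxx; split=> //.
  by rewrite adj_sym.
have [x [y [xA yA xy]]] := cW (A :&: W) (subsetIr _ _) E F.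
exists x, y; move: xA yA; rewrite !inE => /andP[-> xW].
by move=> /andP[+ yW]; rewrite yW andbT orbT => /negPf ->.
Qed.

(** * Bipartite induced subgraphs *)

Definition bipartite_in A :=
  [exists c : {ffun G -> bool},
    [forall x in A, forall y in A, adj x y ==> (c x != c y)]].

Lemma bipartite_inP A :
  reflect (exists c : G -> bool,
             {in A &, forall x y, adj x y -> c x != c y})
          (bipartite_in A).
Proof.
apply: (iffP existsP) => -[c cP].
  exists c => x y xA yA xy.
  by move/forall_inP/(_ x xA)/forall_inP/(_ y yA)/implyP/(_ xy): cP.
exists (finfun c); apply/forall_inP=> x xA; apply/forall_inP=> y yA.
by apply/implyP=> xy; rewrite !ffunE; exact: cP.
Qed.

Lemma nbhS A B x : A \subset B -> nbh A x \subset nbh B x.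
Proof.
by move=> AB; apply/subsetP=> y; rewrite !inE => /andP[/(subsetP AB) -> ->].
Qed.

(** * Inequalities for edge counts and degrees *)

(** The predecessor is truncated at 0, so vertices without neighbours in [N] contribute nothing. *)
Definition excess N A := \sum_(x in A :\: N) (#|nbh N x|.-1).

Lemma excessU1 N A y : y \notin A -> y \notin N ->
  excess N (y |: A) = #|nbh N y|.-1 + excess N A.
Proof.
move=> yA yN; rewrite /excess (big_setD1 y) /=; last by rewrite !inE eqxx yN.
congr (_ + _); apply: eq_bigl => x; rewrite !inE.
by case: eqP => [->|//]; rewrite (negPf yA) andbF.
Qed.

Lemma excessid N : excess N N = 0.
Proof. by rewrite /excess setDv big_set0. Qed.

(** Each vertex attached on the way from [N] to [W], with t neighbours in [N], brings at least
    max(1, t) edges; these pay for the vertex and for its term of the excess. *)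
Lemma edges_in_lower W N : cut_connected W -> N \subset W -> N != set0 ->
  #|edges_in N| + #|W| + excess N W <= #|edges_in W| + #|N|.
Proof.
move=> cW NW N0.
pose P A := #|edges_in N| + #|A| + excess N A <= #|edges_in A| + #|N|.
apply: (cut_connected_ind (P := P) cW NW N0) => [|B y NB BW yW yB n0 IH].
  by rewrite /P excessid addn0.
have yN : y \notin N by apply: contra yB; exact: (subsetP NB).
rewrite /P in IH *; rewrite card_edges_inU1 // excessU1 // cardsU1 yB.
have := subset_leq_card (nbhS y NB).
rewrite -card_gt0 in n0; lia.
Qed.

(* The growth keeps a 2-colouring that is constant on N; the step at which this
   fails attaches a vertex by one edge more than counted. *)
Lemma edges_in_lower_odd W N :
    cut_connected W -> N \subset W -> N != set0 -> ~~ bipartite_in W ->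
    {in N &, forall x y, ~~ adj x y} ->
  #|W| + excess N W < #|edges_in W| + #|N|.
Proof.
move=> cW NW N0 nbW iN.
pose col A := exists2 c : G -> bool, {in N, forall x, c x} &
  {in A &, forall x y, adj x y -> c x != c y}.
pose low A k := #|A| + excess N A + k <= #|edges_in A| + #|N|.
suff : col W /\ low W 0 \/ low W 1.
  case=> [[[c _ cW'] _]|]; last by rewrite /low addn1.
  by case/negP: nbW; apply/bipartite_inP; exists c.
pose P A := col A /\ low A 0 \/ low A 1.
apply: (cut_connected_ind (P := P) cW NW N0) => [|B y NB BW yW yB n0 IH].
  left; split; last by rewrite /low excessid; lia.
  by exists xpredT => // x y xN yN; rewrite (negPf (iN _ _ xN yN)).
have yN : y \notin N by apply: contra yB; exact: (subsetP NB).
rewrite /P /low card_edges_inU1 // excessU1 // cardsU1 yB.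
have nB := subset_leq_card (nbhS y NB).
rewrite -card_gt0 in n0.
case: IH => [[[c cN cB] low0]|]; last by rewrite /low; right; lia.
rewrite /low in low0.
(* If [y] sees both colours, its neighbour [w] lies outside [N], so [y] has at least two neighbours
   in [B] and strictly more there than in [N]. *)
case: (boolP [exists u in nbh B y, exists w in nbh B y, c u && ~~ c w]).
  case/exists_inP=> u uB /exists_inP[w wB /andP[cu cw]]; right.
  have wN : w \notin N by apply: contra cw => /cN.
  have h1 : #|nbh N y| < #|nbh B y|.
    rewrite proper_card // properE nbhS //; apply/subsetPn; exists w => //.
    by rewrite inE (negPf wN).
  have h2 : 1 < #|nbh B y|.
    rewrite (cardsD1 u) uB ltnS card_gt0; apply/set0Pn; exists w.
    by rewrite !in_setD1 wB andbT; apply: contraNneq cw => ->.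
  clear - low0 h1 h2; lia.
move/exists_inPn=> H; left; split; last lia.
(* Otherwise the neighbours of [y] in [B] share one colour, and [k] is the other one. *)
pose k := [forall u in nbh B y, ~~ c u].
exists (fun x => if x == y then k else c x) => [x xN|].
  by case: eqP => [xy|_]; [move: yN; rewrite -xy xN | exact: cN].
have key u : u \in nbh B y -> c u != k.
  move=> uB; rewrite /k; case cu: (c u).
    by apply/eqP=> /esym/forall_inP/(_ u uB); rewrite cu.
  suff -> : [forall u in nbh B y, ~~ c u] by [].
  apply/forall_inP=> w wB; apply/negP=> cw.
  by move/exists_inPn: (H w wB) => /(_ u uB); rewrite cw cu.
move=> x z; rewrite !inE; case: (eqVneq x y) => [->|xy] /=;
  case: (eqVneq z y) => [->|zy] //= xB zB; rewrite ?adj_irr // => a.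
- by rewrite eq_sym key // inE zB.
- by rewrite key // inE xB adj_sym.
- exact: cB.
Qed.

(** The witness [m] is the number of non-isolated vertices of the subgraph induced on [N]. Their
    degrees t satisfy (t - 1)(m - 1 - t) >= 0, and summing this uses the handshake lemma. *)
Lemma sum_nbh_sq N :
  exists2 m, m <= #|N| &
    \sum_(x in N) #|nbh N x| ^ 2 + m * m.-1 <= 2 * #|edges_in N| * m.
Proof.
pose M := [set x in N | nbh N x != set0].
have MN : M \subset N by apply/subsetP=> x; rewrite inE => /andP[].
exists #|M|; first exact: subset_leq_card.
have red (F : nat -> nat) : F 0 = 0 ->
    \sum_(x in N) F #|nbh N x| = \sum_(x in M) F #|nbh N x|.
  move=> F0; rewrite big_mkcond [RHS]big_mkcond; apply: eq_bigr => x _.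
  rewrite inE; case: (x \in N) => //=.
  by case: eqP => [->|//]; rewrite cards0.
rewrite (red (fun n => n ^ 2)) // -sum_card_nbh (red id) //.
rewrite -sum_nat_const big_distrl /= -big_split /=.
apply: leq_sum => x xM.
have h0 : 0 < #|nbh N x| by rewrite card_gt0; move: xM; rewrite inE => /andP[].
have : #|nbh N x| < #|M|.
  rewrite (cardsD1 x M) xM ltnS subset_leq_card //; apply/subsetP=> y.
  rewrite !inE => /andP[yN xy]; rewrite yN eq_sym adj_neq //=.
  by apply/set0Pn; exists x; rewrite inE adj_sym xy andbT (subsetP MN).
move: #|nbh N x| #|M| h0 => h m h0; rewrite -mulnn; nia.
Qed.

(** * Minimal non-bipartite vertex sets *)

(** Across a cut without edges, 2-colourings of the two sides, which exist by minimality, would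
    glue. *)
Lemma minimal_cut_connected W : ~~ bipartite_in W ->
  (forall A, A \proper W -> bipartite_in A) -> cut_connected W.
Proof.
move=> nbW minW A AW A0 AnW.
case: (boolP [exists x in A, exists y in W :\: A, adj x y]).
  by case/exists_inP=> x xA /exists_inP[y yA xy]; exists x, y.
move=> H; case/negP: nbW.
have nadj x y : x \in A -> y \in W -> y \notin A -> adj x y = false.
  move=> xA yW yA; apply: contraNF H => xy.
  apply/exists_inP; exists x => //; apply/exists_inP; exists y => //.
  by rewrite inE yA.
have /minW/bipartite_inP[c cP] : A \proper W.
  by rewrite properEneq AnW.
have /minW/bipartite_inP[k kP] : W :\: A \proper W.
  rewrite properE subsetDl; case/set0Pn: A0 => x xA; apply/subsetPn.
  by exists x; rewrite ?inE ?xA // (subsetP AW).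
apply/bipartite_inP; exists (fun x => if x \in A then c x else k x).
move=> x y xW yW xy; case: (boolP (x \in A)) => xA; case: (boolP (y \in A)) => yA.
- exact: cP.
- by rewrite nadj in xy.
- by rewrite adj_sym nadj in xy.
- by apply: kP; rewrite ?inE ?xA ?yA.
Qed.

Lemma bipartite_in_value A x (s : bool) : bipartite_in A ->
  exists2 c : G -> bool, c x = s &
    {in A &, forall y z, adj y z -> c y != c z}.
Proof.
case/bipartite_inP=> c cP; exists (fun y => c y (+) (c x (+) s)).
  by rewrite addbA addbb.
by move=> y z yA zA yz; rewrite (inj_eq (@addIb _)) cP.
Qed.

(* Let k and m be 2-colourings of W :\ a and W :\ b. They agree on a union D of
   components of W :\: [set a; b] containing c and d. By minimality the rest,
   with a and b, has a 2-colouring p; the 4-cycle forces p = m at a and p = k at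
   b, up to a swap, so p and k glue to a 2-colouring of W. *)
Lemma minimal_no_4cycle W a b c d : ~~ bipartite_in W ->
    (forall A, A \proper W -> bipartite_in A) ->
    [/\ a \in W, b \in W, c \in W & d \in W] ->
    [/\ adj a b, adj b c, adj c d & adj d a] -> a != c -> b != d ->
  False.
Proof.
move=> nbW minW [aW bW cW dW] [ab bc cd da] ac bd; case/negP: nbW.
have nab := adj_neq ab; have ncb := adj_neq bc; rewrite eq_sym in ncb.
have nba : b != a by rewrite eq_sym.
have ca : c != a by rewrite eq_sym.
have db : d != b by rewrite eq_sym.
have [k kc kP] := bipartite_in_value c true (minW _ (properD1 aW)).
have [m mc mP] := bipartite_in_value c true (minW _ (properD1 bW)).
(* [Q] is the complement of D in [W]. *)
pose Q := [set x in W | [|| x == a, x == b | k x != m x]].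
have QW : Q \proper W.
  rewrite properE; apply/andP; split.
    by apply/subsetP=> x; rewrite inE => /andP[].
  apply/subsetPn; exists c => //.
  by rewrite inE (negPf ca) (negPf ncb) kc mc eqxx andbF.
have [p pa pP] := bipartite_in_value a (m a) (minW _ QW).
(* The path c, d, a avoids [b], so [m a] is true; the edge from [b] to [c] avoids [a], so [k b] is
   false; the edge from [a] to [b] makes [p b] opposite to [p a]. *)
have pb : p b = k b.
  have aQ : a \in Q by rewrite inE aW eqxx.
  have bQ : b \in Q by rewrite inE bW eqxx orbT.
  have := pP a b aQ bQ ab; rewrite pa.
  have : m c != m d by apply: mP => //; rewrite !inE ?ncb ?db.
  have : m d != m a by apply: mP => //; rewrite !inE ?db ?nab.
  have : k b != k c by apply: kP => //; rewrite !inE ?ca ?nba.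
  by rewrite kc mc; case: (m a); case: (m d); case: (p b); case: (k b).
(* Outside [Q] the colourings [k] and [m] agree. An edge from [a] is handled by [m] and one from [b]
   by [k]; no other vertex of [Q] has such an edge, since both colourings would flip along it. *)
have key x y : x \in Q -> y \in W -> y \notin Q -> adj x y -> p x != k y.
  move=> xQ yW; rewrite inE yW /= !negb_or negbK => /and3P[ya yb /eqP yk] xy.
  have xW : x \in W by move: xQ; rewrite inE => /andP[].
  case: (eqVneq x a) => [xa|xa].
    by rewrite xa pa yk; apply: mP; rewrite ?inE ?nab ?yb // -xa.
  case: (eqVneq x b) => [xb|xb].
    by rewrite xb pb; apply: kP; rewrite ?inE ?nba ?ya // -xb.
  have : k x != k y by apply: kP; rewrite ?inE ?xa ?ya.
  have : m x != m y by apply: mP; rewrite ?inE ?xb ?yb.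
  move: xQ; rewrite inE (negPf xa) (negPf xb) yk => /andP[_] /=.
  by case: (k x); case: (m x); case: (m y).
apply/bipartite_inP; exists (fun x => if x \in Q then p x else k x).
move=> x y xW yW xy; case: (boolP (x \in Q)) => xQ; case: (boolP (y \in Q)) => yQ.
- exact: pP.
- exact: key.
- by rewrite eq_sym key // adj_sym.
- by apply: kP => //; [move: xQ|move: yQ]; rewrite !inE ?xW ?yW !negb_or => /andP[->].
Qed.

(** * 4-cycles through a given vertex *)

Lemma edge_adj x y : [set x; y] \in edges G -> adj x y.
Proof.
case/edgeP=> [z [w [zw E]]].
have : z \in [set x; y] by rewrite E !inE eqxx.
have : w \in [set x; y] by rewrite E !inE eqxx orbT.
rewrite !inE => /orP[]/eqP wE /orP[]/eqP zE; move: zw; rewrite wE zE ?adj_irr //.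
by rewrite adj_sym.
Qed.

(** For a pair [P] disjoint from distinct [v] and [x], this is the 4-cycle with [v] opposite [x] and
    the two elements of [P] opposite each other. *)
Definition cycle4 v x (P : {set G}) : {set G} * {set {set G}} :=
  ([set v; x] :|: P, [set [set y; z] | y in [set v; x], z in P]).

Lemma is_cycle_adj n (H : {set G} * {set {set G}}) : 2 < n -> is_cycle n H ->
  exists2 f : {ffun 'I_n -> G}, injective f &
    [/\ forall i, adj (f i) (f (ordS i)), H.1 = f @: setT &
        H.2 = [set [set f i; f (ordS i)] | i : 'I_n]].
Proof.
move=> n2 /andP[/andP[/subsetP sE _] /existsP[f /and3P[/injectiveP fI /eqP f1 /eqP f2]]].
have neqS (i : 'I_n) : i != ordS i.
  rewrite -val_eqE /=; have := ltn_ord i.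
  rewrite leq_eqVlt => /orP[/eqP E|lt]; last by rewrite modn_small //; lia.
  by rewrite E modnn; lia.
have eC (i : 'I_n) : [set i; ordS i] \in edges (cycle_graph n).
  by apply/edgeP; exists i, (ordS i); rewrite /= /cycle_adj neqS eqxx.
have H2 : H.2 = [set [set f i; f (ordS i)] | i : 'I_n].
  rewrite -f2; apply/setP=> X; apply/imsetP/imsetP=> [[A]|[i _ ->]].
    case/edgeP=> i [j [/andP[_ /orP[]/eqP -> ->]]] ->.
      by exists i; rewrite ?imsetU1 ?imset_set1.
    by exists j; rewrite ?imsetU1 ?imset_set1 // setUC.
  by exists [set i; ordS i]; rewrite ?imsetU1 ?imset_set1.
exists f => //; split=> // i; apply/edge_adj/sE.
by rewrite H2; apply/imsetP; exists i.
Qed.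

Lemma is_cycle4P (H : {set G} * {set {set G}}) v : is_cycle 4 H -> v \in H.1 ->
  exists x u w, [/\ [/\ adj v u, adj u x, adj x w & adj w v], v != x, u != w
    & H = cycle4 v x [set u; w]].
Proof.
case/is_cycle_adj=> // f fI [fa f1 f2]; rewrite f1 => /imsetP[i _ ->].
pose s j : 'I_4 := ordS j.
have s4 j : s (s (s (s j))) = j by apply/val_inj; case: j => [[|[|[|[|]]]]].
have cover j : [\/ j = i, j = s i, j = s (s i) | j = s (s (s i))].
  case: i {s4} => [[|[|[|[|]]]]] //= hi; case: j => [[|[|[|[|]]]]] //= hj;
  by [apply: Or41; apply/val_inj|apply: Or42; apply/val_inj
     |apply: Or43; apply/val_inj|apply: Or44; apply/val_inj].
have neq j : j != s (s j) by case: j => [[|[|[|[|]]]]].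
exists (f (s (s i))), (f (s i)), (f (s (s (s i)))); split.
- by split; rewrite ?fa // -[in X in adj _ X](s4 i) fa.
- by rewrite (inj_eq fI).
- by rewrite (inj_eq fI).
rewrite (surjective_pairing H) f1 f2; congr (_, _).
  apply/setP=> y; rewrite !inE; apply/imsetP/idP=> [[j _ ->]|].
    by case: (cover j) => ->; rewrite eqxx ?orbT.
  by rewrite -!orbA => /or4P[]/eqP ->; eexists.
apply/setP=> X; apply/imsetP/imset2P=> [[j _ ->]|[y z]].
  rewrite -/(s j); case: (cover j) => ->.
  - by exists (f i) (f (s i)); rewrite ?inE ?eqxx ?orbT.
  - by exists (f (s (s i))) (f (s i)); rewrite ?inE ?eqxx ?orbT // setUC.
  - by exists (f (s (s i))) (f (s (s (s i)))); rewrite ?inE ?eqxx ?orbT.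
  - by exists (f i) (f (s (s (s i)))); rewrite ?s4 ?inE ?eqxx ?orbT // setUC.
rewrite !inE => /orP[]/eqP -> /orP[]/eqP -> ->.
- by exists i.
- by exists (s (s (s i))); rewrite // -/(s _) s4 setUC.
- by exists (s i); rewrite // setUC.
- by exists (s (s i)).
Qed.

Definition cycles4_in A := [set H | is_cycle 4 H & H.1 \subset A].

(** A 4-cycle through [v] is determined by the vertex [x] opposite [v] and the unordered pair of the
    other two, which are common neighbours of [v] and [x]. *)
Lemma card_cycles4_inU1 B v : v \notin B ->
  #|cycles4_in (v |: B)| <=
    #|cycles4_in B| + \sum_(x in B) 'C(#|nbh (nbh B v) x|, 2).
Proof.
move=> vB; pose draws x := [set P : {set G} | P \subset nbh (nbh B v) x & #|P| == 2].
have sub : cycles4_in (v |: B) \subset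
    cycles4_in B :|: \bigcup_(x in B) cycle4 v x @: draws x.
  apply/subsetP=> H; rewrite !inE => /andP[HC HB]; rewrite HC /=.
  case: (boolP (v \in H.1)) => vH; last first.
    apply/orP; left; apply/subsetP=> y yH; have := subsetP HB y yH.
    by rewrite !inE => /orP[/eqP yv|//]; move: vH; rewrite -yv yH.
  apply/orP; right.
  have [x [u [w [[vu ux xw wv] vx uw HE]]]] := is_cycle4P HC vH.
  have inB y : y \in H.1 -> y != v -> y \in B.
    by move=> /(subsetP HB); rewrite !inE => /orP[->|].
  have xB : x \in B by apply: inB; rewrite 1?eq_sym // HE !inE eqxx orbT.
  have uB : u \in B by apply: inB; rewrite 1?eq_sym ?adj_neq // HE !inE eqxx !orbT.
  have wB : w \in B by apply: inB; rewrite ?adj_neq // HE !inE eqxx !orbT.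
  apply/bigcupP; exists x => //; apply/imsetP; exists [set u; w] => //.
  rewrite inE cards2 uw andbT; apply/subsetP=> y.
  by rewrite !inE => /orP[]/eqP ->; rewrite ?uB ?wB ?vu ?xw adj_sym ?ux ?wv.
apply: leq_trans (subset_leq_card sub) _.
apply: leq_trans (leq_card_setU _ _).1 _; rewrite leq_add2l.
apply: (@leq_trans (\sum_(x in B) #|cycle4 v x @: draws x|)).
  elim/big_rec2: _ => [|x n X _ IH]; first by rewrite cards0.
  by apply: leq_trans (leq_card_setU _ _).1 _; rewrite leq_add2l.
by apply: leq_sum => x _; rewrite -cards_draws leq_imset_card.
Qed.

(** * Binomial bound for one growth step *)

Lemma double_bin2 n : 2 * 'C(n, 2) = n * n.-1.
Proof. by rewrite -mul_bin_diag bin1. Qed.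

Lemma sum_bin2_nbh B N b : cut_connected B -> ~~ bipartite_in B ->
    N \subset B -> N != set0 -> 0 < b -> #|edges_in B| + 1 = #|B| + b ->
  'C(b, 2) + \sum_(x in B) 'C(#|nbh N x|, 2) <= 'C(b + #|N|.-1, 2).
Proof.
move=> cB nbB NB N0 b0 eB.
have n0 : 0 < #|N| by rewrite card_gt0.
have tN x : #|nbh N x| <= #|N|.
  by apply: subset_leq_card; apply/subsetP=> y; rewrite inE => /andP[].
pose sq A := \sum_(x in A) #|nbh N x| * (#|nbh N x|).-1.
have sumE : 2 * \sum_(x in B) 'C(#|nbh N x|, 2) = sq N + sq (B :\: N).
  rewrite big_distrr /= (big_setID N) /= (setIidPr NB) /sq.
  by congr (_ + _); apply: eq_bigr => x _; rewrite double_bin2.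
suff : sq N + sq (B :\: N) <= 2 * (#|N|.-1 * b) + #|N|.-1 * (#|N|.-1).-1.
  rewrite -sumE => hs; rewrite -(leq_pmul2l (isT : 0 < 2)) mulnDr !double_bin2.
  move: (\sum_(_ in _) _) #|N|.-1 b0 hs {eB sumE n0} => s d b0 hs.
  have : (b + d) * (b + d).-1 + (b + d) = (b + d) * (b + d).
    by rewrite -mulnSr prednK // addn_gt0 b0.
  have : b * b.-1 + b = b * b by rewrite -mulnSr prednK.
  have : d * d.-1 + d = d * d by rewrite -mulnSr; case: (d).
  move: (d * d.-1) (b * b.-1) (_ * _.-1) hs => d2 b2 bd2; clear; lia.
(* [step_arith] needs d > 0; for a single vertex [N] every t_x is at most 1 and both sums vanish. *)
case: (posnP #|N|.-1) => [N1|N1].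
  have z A : sq A = 0.
    rewrite /sq big1 // => x _; have := tN x.
    rewrite (_ : #|N| = 1); last by lia.
    by case: #|nbh N x| => [|[|]].
  by rewrite !z.
have [m mN hm] := sum_nbh_sq N.
apply: (@step_arith _ _ #|edges_in N| (excess N B) m) => //.
- lia.
- apply: leq_trans _ hm; rewrite leq_add2r -sum_card_nbh -big_split /=.
  apply: leq_sum => x _.
  by case: #|nbh N x| => // t; rewrite -mulnSr.
- rewrite prednK // /sq /excess big_distrr /=.
  by apply: leq_sum => x _; rewrite leq_mul2r tN orbT.
- rewrite /sq {2}/excess big_distrr /=; apply: leq_sum => x xB.
  rewrite leq_mul2r; apply/orP; right.
  have : #|nbh N x|.-1 <= excess N B by rewrite /excess (big_setD1 x) //= leq_addr.
  lia.
- have := edges_in_lower cB NB N0; lia.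
(* For the strict bound S < b + d, an edge inside [N] suffices; otherwise [N] is independent and
   non-bipartiteness of [B] gives the extra 1. *)
case: (posnP #|edges_in N|) => [q0|q0]; last first.
  have := edges_in_lower cB NB N0; lia.
suff iN : {in N &, forall x y, ~~ adj x y}.
  have := edges_in_lower_odd cB NB N0 nbB iN; lia.
move=> x y xN yN; apply/negP=> xy; move/eqP: q0; apply/negP.
rewrite -lt0n card_gt0; apply/set0Pn; exists [set x; y].
rewrite inE subUset !sub1set xN yN !andbT.
by apply/edgeP; exists x, y.
Qed.

(** * Odd cycles and connectedness of the whole graph *)

(** A 2-colouring alternates along a cycle, so going once round an odd one would flip the colour of
    the starting vertex. *)
Lemma odd_cycle_not_bipartite : has_odd_cycle G -> ~~ bipartite_in [set: G].
Proof.
case=> n [n3 on [H /(is_cycle_adj n3)[f _ [fa _ _]]]].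
apply/negP=> /bipartite_inP[c cP].
have cS i : c (f (ordS i)) = ~~ c (f i).
  have := cP _ _ (in_setT _) (in_setT _) (fa i).
  by case: (c (f i)); case: (c _).
case: n n3 on {H} f fa cS => // n n3 on f _ cS.
have step k : k <= n -> c (f (inord k)) = c (f ord0) (+) odd k.
  elim: k => [_|k IH kn].
    by rewrite addbF; congr (c (f _)); apply/val_inj; rewrite /= inordK.
  have -> : inord k.+1 = ordS (inord k : 'I_n.+1).
    by apply/val_inj; rewrite /= !inordK ?modn_small // ltnW.
  by rewrite cS IH 1?ltnW //= addbN.
have := cS (inord n); rewrite step // (_ : ordS _ = ord0).
  by rewrite [odd n](_ : _ = false) ?addbF; [case: (c _) | move: on => /=; case: odd].
by apply/val_inj; rewrite /= inordK // modnn.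
Qed.

Lemma connected_cut_connected : connected_graph G -> cut_connected [set: G].
Proof.
move=> cG A _ /set0Pn[x xA] AT.
case: (boolP [exists x in A, exists y in [set: G] :\: A, adj x y]).
  by case/exists_inP=> u uA /exists_inP[w wA uw]; exists u, w.
move=> H; case/negP: AT; rewrite eqEsubset subsetT; apply/subsetP=> y _.
have stA u w : adj u w -> u \in A -> w \in A.
  move=> uw uA; apply: contraNT H => wA; apply/exists_inP; exists u => //.
  by apply/exists_inP; exists w; rewrite ?inE ?wA.
have clA : closed (@adj G) A.
  by move=> u w uw; apply/idP/idP; apply: stA; rewrite // adj_sym.
by rewrite -(closed_connect clA (cG x y)).
Qed.

End FourCycles.

(** * Induction from a minimal non-bipartite set *)

Theorem theorem2p5 (G : sgraph) (hconn : connected_graph G)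
    (hodd : has_odd_cycle G) :
  c4 G <= 'C(#|edges G| + 1 - #|G|, 2).
Proof.
have [W /minsetP[nbW minW] _] :=
  minset_exists (P := fun A : {set G} => ~~ bipartite_in A)
    (odd_cycle_not_bipartite hodd).
have {}minW (A : {set G}) : A \proper W -> bipartite_in A.
  move=> AW; apply: contraTT AW => nbA; apply/negP=> AW.
  by move: (AW); rewrite properEneq (minW _ nbA (proper_sub AW)) eqxx.
have cW := minimal_cut_connected nbW minW.
have /set0Pn[x0 x0W] : W != set0.
  apply: contraNneq nbW => ->; apply/bipartite_inP.
  by exists xpredT => x y; rewrite inE.
have low := edges_in_lower_odd cW (N := [set x0]).
(* An equation fixes [b], which keeps truncated subtraction out of the induction. *)
pose P (B : {set G}) := cut_connected B /\ exists b, [/\ 0 < b,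
  #|edges_in B| + 1 = #|B| + b & #|cycles4_in B| <= 'C(b, 2)].
suff [_ [b [_ eb c4b]]] : P [set: G].
  have -> : #|edges G| + 1 - #|G| = b.
    rewrite cardsT in eb; rewrite (_ : edges G = edges_in [set: G]).
      by rewrite eb addKn.
    by apply/setP=> X; rewrite inE subsetT andbT.
  rewrite (_ : c4 G = #|cycles4_in [set: G]|) //.
  by apply: eq_card => H; rewrite !inE subsetT andbT.
apply: (cut_connected_ind (P := P) (connected_cut_connected hconn) (subsetT W)).
- by apply/set0Pn; exists x0.
- split=> //; exists (#|edges_in W| + 1 - #|W|).
  (* Growing from the single vertex [x0] gives b >= 1 for [W]. *)
  have : #|W| + excess [set x0] W < #|edges_in W| + #|[set x0]|.
    apply: low => //; rewrite ?sub1set //; first by apply/set0Pn; exists x0; rewrite inE.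
    by move=> x y /set1P-> /set1P->; rewrite adj_irr.
  rewrite cards1 => lt; split; try lia.
  rewrite (_ : cycles4_in W = set0) ?cards0 //.
  apply/setP=> H; rewrite !inE; apply/negP=> /andP[HC HW].
  have /set0Pn[v vH] : H.1 != set0.
    have [f _ [_ -> _]] := @is_cycle_adj G 4 H isT HC.
    by apply/set0Pn; exists (f ord0); apply: imset_f.
  have [x [u [w [[vu ux xw wv] vx uw HE]]]] := is_cycle4P HC vH.
  apply: (@minimal_no_4cycle _ W v u x w) => //.
  by split; apply: (subsetP HW); rewrite HE !inE eqxx ?orbT.
move=> B y WB _ _ yB n0 [cB [b [b0 eb c4b]]]; split.
  exact: cut_connectedU1.
have nbB : ~~ bipartite_in B.
  apply: contra nbW => /bipartite_inP[c cP]; apply/bipartite_inP; exists c.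
  by move=> u w uW wW; apply: cP; exact: (subsetP WB).
have NB : nbh B y \subset B by apply/subsetP=> x; rewrite inE => /andP[].
exists (b + #|nbh B y|.-1); split.
- by rewrite addn_gt0 b0.
- rewrite card_edges_inU1 // cardsU1 yB; rewrite -card_gt0 in n0; lia.
apply: leq_trans (card_cycles4_inU1 yB) _.
apply: leq_trans (sum_bin2_nbh cB nbB NB n0 b0 eb).
by rewrite leq_add2r.
Qed.
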